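(* For any sets $A,B$ of nonnegative integers that are additive complements, $$SX(A,B):=\limsup_{x\to\infty}\frac{\max\{A(x),B(x)\}}{\sqrt x}\ \ge\ \sqrt{1+C_0},\qquad\text{where } C_0=\tfrac12\left(-3-\sqrt2+\sqrt{3+12\sqrt2}\right).$$
   Context: Two sets $A,B$ of nonnegative integers are called additive complements if every sufficiently large integer can be written as $a+b$ with $a\in A$, $b\in B$. For a set $A$ of nonnegative integers, $A(x)$ denotes the number of elements $a\in A$ with $a\le x$. Note $\sqrt{1+C_0}=1.013565\ldots$. *)

(* Defs.v *)
From HB Require Import structures.
From mathcomp Require Import all_boot all_order all_algebra finmap.
From mathcomp Require Import all_classical all_reals all_analysis.

Set Implicit Arguments.
Unset Strict Implicit.
Unset Printing Implicit Defensive.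

Import Order.TTheory GRing.Theory Num.Theory.
Import numFieldNormedType.Exports.

Local Open Scope classical_set_scope.
Local Open Scope ring_scope.

Definition additive_complements (A B : set nat) : Prop :=
  exists N : nat, forall n : nat, (N <= n)%N ->
    exists a b : nat, [/\ A a, B b & n = (a + b)%N].

Definition upto (R : realType) (A : set nat) (x : R) : set nat :=
  [set a | A a /\ a%:R <= x].

(* [fset_set] returns a junk value on infinite sets; this rules that out in
   [counting_fun]. *)
Lemma finite_upto (R : realType) (A : set nat) (x : R) :
  finite_set (upto A x).
Proof.
apply: (sub_finite_set _ (finite_II (Num.truncn x).+1)) => a [_ ax] /=.
rewrite ltnS truncn_ge_nat //; exact: le_trans ax.
Qed.

Definition counting_fun (R : realType) (A : set nat) (x : R) : nat :=
  #|` fset_set (upto A x)|%fset.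

(* The limit superior is over real x and valued in \bar R: it may be +oo. *)
Definition SX (R : realType) (A B : set nat) : \bar R :=
  limf_esup
    (fun x : R =>
       ((maxn (counting_fun A x) (counting_fun B x))%:R / Num.sqrt x)%:E)
    (pinfty_nbhs R).

Definition C0 (R : realType) : R :=
  (- 3 - Num.sqrt 2 + Num.sqrt (3 + 12 * Num.sqrt 2)) / 2.

(* Main.v *)
Require Import Defs.
From mathcomp Require Import all_boot all_order all_algebra.
From mathcomp Require Import all_classical all_reals all_analysis.
From mathcomp Require Import finmap ring lra zify.

(** If [a + b <= 2m] then [a <= m] or [b <= m], so all large integers up to
    [2m] are represented by pairs counted by
    [A(m) B(2m) + A(2m) B(m) - A(m) B(m)]. If [A(x)] and [B(x)] are at most
    [d sqrt x], this is at most [d^2 m (2 sqrt 2 - 1)], whence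
    [d^2 >= 2 / (2 sqrt 2 - 1) = 1.0938...], which exceeds
    [1 + C0 = 1.0273...]. *)

Set Implicit Arguments.
Unset Strict Implicit.
Unset Printing Implicit Defensive.

Import Order.TTheory GRing.Theory Num.Theory.

Local Open Scope classical_set_scope.
Local Open Scope ring_scope.

Lemma counting_fun_le_sqrt (R : realType) (A B : set nat) (d x : R) :
  0 < x ->
  (maxn (counting_fun A x) (counting_fun B x))%:R / Num.sqrt x <= d ->
  (counting_fun A x)%:R <= d * Num.sqrt x /\
  (counting_fun B x)%:R <= d * Num.sqrt x.
Proof.
move=> x0; rewrite ler_pdivrMr ?sqrtr_gt0// => h.
by split; apply: le_trans h; rewrite ler_nat ?leq_maxl ?leq_maxr.
Qed.

(** The integers from [N] to [2m] are distinct sums, so there are at most as many of them as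
    admissible pairs. The product [cA m * cB m] stands on the left to keep truncated subtraction out
    of the bound. *)
Lemma complements_pair_count (R : realType) (A B : set nat) (N m : nat)
    (cA := fun k => counting_fun A (k%:R : R))
    (cB := fun k => counting_fun B (k%:R : R)) :
  (forall n, (N <= n)%N -> exists a b, [/\ A a, B b & n = (a + b)%N]) ->
  (m.*2 + cA m * cB m <= N + cA m * cB m.*2 + cA m.*2 * cB m)%N.
Proof.
move=> hN.
pose F (X : set nat) k := fset_set (upto X (k%:R : R)).
have inF X k a : (a \in F X k) = `[< X a >] && (a <= k)%N.
  rewrite in_fset_set; last exact: finite_upto.
  apply/idP/andP => [/set_mem[Xa]|[/asboolP Xa ak]].
    by rewrite ler_nat; split => //; apply/asboolP.
  by apply: mem_set; split => //; rewrite ler_nat.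
have subF X : (F X m `<=` F X m.*2)%fset.
  apply/fsubsetP => a; rewrite !inF => /andP[-> am] /=.
  by rewrite (leq_trans am)// -addnn leq_addr.
(* Pairs are split by whether [a <= m]; if [a > m], then [a + b <= 2m] forces [b <= m]. *)
pose s := [seq (a + b)%N | a <- F A m, b <- F B m.*2] ++
  [seq (a + b)%N | a <- (F A m.*2 `\` F A m)%fset, b <- F B m].
have : (size (iota N (m.*2.+1 - N)) <= size s)%N.
  apply: uniq_leq_size; first exact: iota_uniq.
  move=> n; rewrite mem_iota => /andP[Nn nm].
  have [a [b [Aa Bb nab]]] := hN _ Nn.
  rewrite mem_cat nab; have [am|ma] := leqP a m; apply/orP; [left|right].
    by apply: allpairs_f; rewrite inF; apply/andP; split;
      [exact/asboolP| |exact/asboolP|]; lia.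
  apply: allpairs_f; last by rewrite inF; apply/andP; split; [exact/asboolP|lia].
  rewrite in_fsetD !inF (asboolT Aa) /=; lia.
rewrite size_iota size_cat !size_allpairs.
have -> : size (F A m.*2 `\` F A m)%fset = (cA m.*2 - cA m)%N by exact: cardfsDS.
have := fsubset_leq_card (subF A).
rewrite -[size (F A m)]/(cA m) -[size (F B m)]/(cB m) mulnBl.
rewrite -[size (F B m.*2)]/(cB m.*2) => h.
(* This makes the subtraction left by [mulnBl] an exact one. *)
have : (cA m * cB m <= cA m.*2 * cB m)%N by rewrite leq_mul.
lia.
Qed.

(* Since [(c - a)(c - b) >= (c - h)^2], the maximum is at [a = b = h]. *)
Lemma cross_terms_le (R : realFieldType) (a b a2 b2 h c : R) :
  0 <= a <= h -> 0 <= b <= h -> a2 <= c -> b2 <= c -> h <= c ->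
  a * b2 + a2 * b - a * b <= 2 * c * h - h ^+ 2.
Proof. by move=> /andP[? ?] /andP[? ?] ? ? ?; nra. Qed.

Lemma SX_lower_bound (R : realType) (A B : set nat) :
  additive_complements A B ->
  ((Num.sqrt (2 / (2 * Num.sqrt 2 - 1) : R))%:E <= SX R A B)%E.
Proof.
(* The limsup is an infimum of suprema over neighbourhoods of infinity; if it is too small, so is
   the supremum [S] over some [V] containing all [x > M]. *)
move=> [N hN]; rewrite leNgt; apply/negP => /ereal_inf_lt [_ [V [M [_ MV]] <-]].
set r : R := Num.sqrt 2.
have r0 : 0 <= r by exact: sqrtr_ge0.
have rr : r ^+ 2 = 2 by rewrite sqr_sqrtr.
have r1 : 1 < r by nra.
set f := fun x : R => _; set S := ereal_sup _ => Sc.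
have leS x : M < x -> (f x <= S)%E.
  by move=> Mx; apply: ereal_sup_ubound; exists x => //; exact: MV.
(* One sample value of [f] shows that [S] is not minus infinity and that [d >= 0]. *)
have := leS (M + 1) ltac:(lra).
case: S leS Sc => [d leS| // |leS _ _]; last by have := leS (M + 1) ltac:(lra).
rewrite lte_fin => dc d0; have {}d0 : 0 <= d.
  by move: d0; rewrite lee_fin; apply: le_trans; rewrite divr_ge0 ?sqrtr_ge0.
have {dc} dd : d ^+ 2 * (2 * r - 1) < 2.
  rewrite -ltr_pdivlMr; last lra.
  have k0 : 0 <= 2 / (2 * r - 1) by rewrite divr_ge0//; lra.
  by rewrite -[ltRHS](sqr_sqrtr k0) ltr_sqr// nnegrE sqrtr_ge0.
(* The pair count will give [2m <= N + (2 - e) m], which fails once [m > N / e]. *)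
set e := 2 - d ^+ 2 * (2 * r - 1); have e0 : 0 < e by rewrite /e; lra.
pose m := (Num.truncn (Num.max M (N%:R / e))).+1.
have : Num.max M (N%:R / e) < m%:R by exact: truncnS_gt.
rewrite gt_max ltr_pdivrMr// => /andP[Mm Nm].
have m0 : (0 : R) < m%:R by rewrite ltr0n.
have m2 : (m.*2)%:R = 2 * m%:R :> R by rewrite -mul2n natrM.
have bnd x : 0 < x -> M < x -> _ := fun x0 Mx =>
  @counting_fun_le_sqrt R A B d x x0 (leS x Mx).
have [A1 B1] := bnd _ m0 Mm.
have [A2 B2] := bnd (m.*2)%:R ltac:(lra) ltac:(lra).
have := @complements_pair_count R A B N m hN.
rewrite -(ler_nat R) !natrD !natrM m2 in A2 B2 *.
set a := (counting_fun A m%:R)%:R in A1 *.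
set b := (counting_fun B m%:R)%:R in B1 *.
set a2 := (counting_fun A _)%:R in A2 *.
set b2 := (counting_fun B _)%:R in B2 *.
rewrite sqrtrM// -/r in A2 B2.
set s := Num.sqrt m%:R in A1 B1 A2 B2; have s0 : 0 <= s by exact: sqrtr_ge0.
have ss : s ^+ 2 = m%:R by rewrite sqr_sqrtr// ltW.
have ds : 0 <= d * s by exact: mulr_ge0.
have rds : d * s <= d * (r * s) by rewrite ler_wpM2l// ler_peMl// ltW.
have a01 : 0 <= a <= d * s by rewrite ler0n.
have b01 : 0 <= b <= d * s by rewrite ler0n.
(* Here [h = d sqrt m] and [c = d sqrt (2m)]. *)
have := cross_terms_le a01 b01 A2 B2 rds.
have -> : 2 * (d * (r * s)) * (d * s) - (d * s) ^+ 2 = (2 - e) * m%:R.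
  by rewrite -ss /e; ring.
lra.
Qed.

Theorem theorem2 (R : realType) (A B : set nat)
    (hAB : additive_complements A B) :
  ((Num.sqrt (1 + C0 R))%R%:E <= SX R A B)%E.
Proof.
apply: le_trans (@SX_lower_bound R A B hAB).
rewrite lee_fin ler_wsqrtr// /C0; set r := Num.sqrt 2.
have r0 : 0 <= r by exact: sqrtr_ge0.
have rr : r ^+ 2 = 2 by rewrite sqr_sqrtr.
have [r1 r2] : 1 < r /\ r < 71 / 50 by split; nra.
(* The term [r] cancels in [C0], leaving [1 + C0 <= 1.03], while [r < 1.42] gives
   [2 / (2 r - 1) > 1.08]. *)
have qr : Num.sqrt (3 + 12 * r) <= 153 / 50 + r.
  rewrite -ler_sqr ?nnegrE ?sqrtr_ge0 ?sqr_sqrtr; nra.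
rewrite ler_pdivlMr; nra.
Qed.
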